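(* Let $n\ge 2$. (i) There exists a maximally antipodal subset of $\mathcal F_{2,2n-2}$ homeomorphic to the $2$-sphere $S^2$. (ii) There exists a maximally antipodal subset of $\mathrm{Iso}_2(\mathbb R^{2n})$ homeomorphic to $S^{2n-3}$.
   Context: $\mathcal F_{2,2n-2}$ is the manifold of pairs $(V,W)$ of linear subspaces of $\mathbb R^{2n}$ with $\dim V=2$, $\dim W=2n-2$, $V\subset W$ (a flag manifold of $\mathrm{SL}(2n,\mathbb R)$); two such pairs $(V,W),(V',W')$ are antipodal if $V\oplus W'=\mathbb R^{2n}$ and $V'\oplus W=\mathbb R^{2n}$. $\mathrm{Iso}_2(\mathbb R^{2n})$ is the manifold of $2$-planes in $\mathbb R^{2n}$ isotropic for a fixed symplectic form $\omega$; two isotropic planes $V,W$ are antipodal if $V\oplus W^{\perp_\omega}=\mathbb R^{2n}$. A subset $\Lambda$ of a flag manifold is antipodal if any two distinct points of $\Lambda$ are antipodal, and maximally antipodal if it is antipodal and every point of the flag manifold is non-antipodal to at least one point of $\Lambda$. *)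

(* Defs.v *)
From HB Require Import structures.
From mathcomp Require Import all_boot all_order all_algebra.
From mathcomp Require Import all_classical all_reals all_analysis.
Set Implicit Arguments. Unset Strict Implicit. Unset Printing Implicit Defensive.
Import Order.TTheory GRing.Theory Num.Theory.
Import numFieldNormedType.Exports.
Local Open Scope classical_set_scope.
Local Open Scope ring_scope.

(* Linear subspaces of R^N are represented faithfully and uniquely by their
   orthogonal projection matrices P (P^2 = P, P^T = P); the subspace is the row
   space of P, its dimension is \rank P.  The manifold topology of the
   Grassmannian/flag manifold is the subspace topology of this (standard)
   embedding into the matrix space 'M[R]_N. *)
Definition is_orthoproj (R : realType) (N : nat) (P : 'M[R]_N) : Prop :=
  P *m P = P /\ P^T = P.

Definition grass (R : realType) (N k : nat) : set 'M[R]_N :=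
  [set P | is_orthoproj P /\ \rank P = k].

Definition complementary (R : realType) (N m p : nat)
  (U : 'M[R]_(m, N)) (W : 'M[R]_(p, N)) : Prop :=
  (U + W :=: (1%:M : 'M[R]_N))%MS /\ (U :&: W = 0)%MS.

Definition flag22 (R : realType) (n : nat) : set ('M[R]_(n.*2) * 'M[R]_(n.*2)) :=
  [set x | grass 2 x.1 /\ grass (n.*2 - 2) x.2 /\ (x.1 <= x.2)%MS].

Definition antipodal_flag (R : realType) (n : nat)
  (x y : 'M[R]_(n.*2) * 'M[R]_(n.*2)) : Prop :=
  complementary x.1 y.2 /\ complementary y.1 x.2.

(* a symplectic form on R^N : omega(u, v) = u *m Om *m v^T, with Om
   antisymmetric and invertible *)
Definition symplectic_mx (R : realType) (N : nat) (Om : 'M[R]_N) : Prop :=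
  Om^T = - Om /\ Om \in unitmx.

Definition iso2 (R : realType) (n : nat) (Om : 'M[R]_(n.*2)) : set 'M[R]_(n.*2) :=
  [set P | grass 2 P /\ P *m Om *m P^T = 0].

Definition symp_orth (R : realType) (N : nat) (Om Q : 'M[R]_N) : 'M[R]_N :=
  kermx (Om *m Q^T).

Definition antipodal_iso (R : realType) (N : nat) (Om : 'M[R]_N) (V W : 'M[R]_N) : Prop :=
  complementary V (symp_orth Om W).

Definition antipodal_set (T : Type) (antip : T -> T -> Prop) (L : set T) : Prop :=
  forall x y, L x -> L y -> x <> y -> antip x y.

Definition maximally_antipodal (T : Type) (F : set T) (antip : T -> T -> Prop)
  (L : set T) : Prop :=
  L `<=` F /\ antipodal_set antip L /\
  (forall x, F x -> exists2 y, L y & ~ antip x y).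

Definition sphere (R : realType) (k : nat) : set 'rV[R]_(k.+1) :=
  [set x | \sum_(i < k.+1) (x ord0 i) ^+ 2 = 1].

Definition homeomorphic (X Y : topologicalType) (A : set X) (B : set Y) : Prop :=
  exists (f : X -> Y) (g : Y -> X),
    [/\ (forall a, A a -> B (f a)), (forall b, B b -> A (g b)),
        (forall a, A a -> g (f a) = a) & (forall b, B b -> f (g b) = b)] /\
    {within A, continuous f} /\ {within B, continuous g}.

(* Main.v *)
Require Import Defs.
From HB Require Import structures.
From mathcomp Require Import all_boot all_order all_algebra.
From mathcomp Require Import all_classical all_reals all_analysis.
From mathcomp Require Import ring lra.
Import Order.TTheory GRing.Theory Num.Theory.
Import numFieldNormedType.Exports.
Local Open Scope classical_set_scope.
Local Open Scope ring_scope.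
Set Implicit Arguments. Unset Strict Implicit. Unset Printing Implicit Defensive.

(* (i) Split R^(2n) as C^2 + R^(2n-4).  To a complex line l of C^2 attach the flag
   (l, l + R^(2n-4)).  Distinct complex lines are transverse, and every vector of
   R^(2n) lies in some l + R^(2n-4), so no flag is antipodal to all of these.  The
   complex lines form a 2-sphere.
   (ii) Identify the symplectic form with the imaginary part of a Hermitian form h of
   signature (n-1, 1) on C^n = C + C^(n-1).  The null complex lines, spanned by (1, s)
   with s in the unit sphere S^(2n-3) of C^(n-1), are isotropic and pairwise antipodal.
   On an isotropic real plane h is real and not negative definite, since h has
   only one negative direction; so the plane contains w = (b, a) <> 0 with |b| <= |a|,
   and even |b| = |a| when n = 2.  Such a w is h-orthogonal to (1, s) for some s.
   In both cases the sphere maps continuously and injectively to projections, hence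
   homeomorphically by compactness. *)

(** * Euclidean inner product and orthogonal projections *)

Section Dot.
Context {R : realFieldType}.

Definition dot n (u v : 'rV[R]_n) : R := (u *m v^T) ord0 ord0.

Lemma dotE n (u v : 'rV[R]_n) : dot u v = \sum_i u ord0 i * v ord0 i.
Proof. by rewrite /dot mxE; apply: eq_bigr => i _; rewrite mxE. Qed.

Lemma dot_mx n (u v : 'rV[R]_n) : u *m v^T = (dot u v)%:M.
Proof. exact: mx11_scalar. Qed.

Lemma dotC n (u v : 'rV[R]_n) : dot u v = dot v u.
Proof. by rewrite !dotE; apply: eq_bigr => i _; rewrite mulrC. Qed.

Lemma dotDl n (u v w : 'rV[R]_n) : dot (u + v) w = dot u w + dot v w.
Proof. by rewrite /dot mulmxDl mxE. Qed.

Lemma dotZl n c (u v : 'rV[R]_n) : dot (c *: u) v = c * dot u v.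
Proof. by rewrite /dot -scalemxAl mxE. Qed.

Lemma dotDr n (u v w : 'rV[R]_n) : dot w (u + v) = dot w u + dot w v.
Proof. by rewrite dotC dotDl !(dotC w). Qed.

Lemma dotZr n c (u v : 'rV[R]_n) : dot u (c *: v) = c * dot u v.
Proof. by rewrite dotC dotZl dotC. Qed.

Lemma dotNl n (u v : 'rV[R]_n) : dot (- u) v = - dot u v.
Proof. by rewrite /dot mulNmx mxE. Qed.

Lemma dotNr n (u v : 'rV[R]_n) : dot u (- v) = - dot u v.
Proof. by rewrite dotC dotNl dotC. Qed.

Definition dot_lin := (dotDl, dotDr, dotZl, dotZr, dotNl, dotNr).

Lemma dot_ge0 n (u : 'rV[R]_n) : 0 <= dot u u.
Proof. by rewrite dotE; apply: sumr_ge0 => i _; rewrite -expr2 sqr_ge0. Qed.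

Lemma dot_eq0 n (u : 'rV[R]_n) : (dot u u == 0) = (u == 0).
Proof.
apply/idP/eqP => [|->]; last by rewrite /dot mul0mx mxE.
rewrite dotE psumr_eq0 => [/allP u0|i _]; last by rewrite -expr2 sqr_ge0.
apply/rowP => i; rewrite mxE; apply/eqP.
by have := u0 i (mem_index_enum _); rewrite mulf_eq0 orbb.
Qed.

(** Equality case of Cauchy-Schwarz: |u - v|^2 = 1 + 1 - 2 = 0. *)
Lemma dot_unit_eq n (u v : 'rV[R]_n) :
  dot u u = 1 -> dot v v = 1 -> dot u v = 1 -> u = v.
Proof.
move=> uu vv uv; apply/eqP; rewrite -subr_eq0 -dot_eq0 !dot_lin.
by rewrite uu vv (dotC v) uv; apply/eqP; ring.
Qed.

Lemma row_free_gram m n (C : 'M[R]_(m, n)) : row_free C -> C *m C^T \in unitmx.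
Proof.
move=> fC; rewrite -row_free_unit -kermx_eq0; apply/rowV0P => x /sub_kermxP xCC.
have xC0 : x *m C == 0 by rewrite -dot_eq0 /dot trmx_mul mulmxA -(mulmxA x) xCC mul0mx mxE.
by move: xC0; rewrite mulmx_free_eq0 // => /eqP.
Qed.

(** For the full-rank factorisation [col_base P *m row_base P], idempotence makes the reversed
    product the identity of size [\rank P], and the trace is cyclic. Ranks of block projections are
    computed this way. *)
Lemma mxrank_idem_trace n (P : 'M[R]_n) : P *m P = P -> \tr P = (\rank P)%:R.
Proof.
move=> PP; rewrite -[in LHS](mulmx_base P) mxtrace_mulC.
suff -> : row_base P *m col_base P = 1%:M by rewrite mxtrace1.
apply: (row_free_inj (row_base_free P)); rewrite mul1mx.
have /row_fullP[D DC] := col_base_full P.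
have DP : D *m P = row_base P by rewrite -[X in D *m X]mulmx_base mulmxA DC mul1mx.
by rewrite -mulmxA mulmx_base -DP -mulmxA PP.
Qed.

(** The Gram matrix formula for the orthogonal projection onto the row space, valid when the rows of
    [C] are independent. *)
Definition orthoproj m n (C : 'M[R]_(m, n)) : 'M[R]_n :=
  C^T *m invmx (C *m C^T) *m C.

Lemma mul_orthoproj m n (C : 'M[R]_(m, n)) : row_free C -> C *m orthoproj C = C.
Proof. by move=> /row_free_gram fC; rewrite /orthoproj !mulmxA mulmxV // mul1mx. Qed.

Lemma orthoproj_sub m n (C : 'M[R]_(m, n)) : (orthoproj C <= C)%MS.
Proof. exact: submxMl. Qed.

Lemma eqmx_orthoproj m n (C : 'M[R]_(m, n)) : row_free C -> (orthoproj C :=: C)%MS.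
Proof.
move=> fC; apply/eqmxP; rewrite orthoproj_sub /=.
by rewrite -{1}(mul_orthoproj fC) submxMl.
Qed.

Lemma orthoproj_idem m n (C : 'M[R]_(m, n)) :
  row_free C -> orthoproj C *m orthoproj C = orthoproj C.
Proof. by move=> fC; rewrite {1}/orthoproj -mulmxA mul_orthoproj. Qed.

Lemma orthoproj_sym m n (C : 'M[R]_(m, n)) : (orthoproj C)^T = orthoproj C.
Proof. by rewrite /orthoproj !trmx_mul trmxK trmx_inv trmx_mul trmxK mulmxA. Qed.

Lemma row_base_of_rank m n r (A : 'M[R]_(m, n)) : \rank A = r ->
  exists2 K : 'M[R]_(r, n), row_free K & (K :=: A)%MS.
Proof. by move=> <-; exists (row_base A); [exact: row_base_free|exact: eq_row_base]. Qed.

End Dot.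

(** * Symplectic normal forms and complex structures *)

Section Symplectic.
Context {R : realFieldType}.

(** The two conditions make [J] orthogonal; it serves both as multiplication by i and as the matrix
    of a symplectic form. *)
Definition complex_structure n (J : 'M[R]_n) := J^T = - J /\ J *m J = - 1%:M.

(** Multiplication by i on C = R^2, acting on row vectors. *)
Definition J2 : 'M[R]_(1 + 1) := block_mx 0 1%:M (- 1%:M) 0.

Lemma J2_complex : complex_structure J2.
Proof.
split; first by rewrite tr_block_mx !linear0 linearN /= trmx1 opp_block_mx !oppr0 opprK.
rewrite mulmx_block !mul0mx !mulmx0 !mulmxN !mulNmx !mulmx1 !addr0 !add0r.
by rewrite [in RHS](@scalar_mx_block _ 1 1) opp_block_mx !oppr0.
Qed.

Lemma complex_structure_unit n (J : 'M[R]_n) : complex_structure J -> J \in unitmx.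
Proof.
move=> [_ JJ]; have : J *m (- J) = 1%:M by rewrite mulmxN JJ opprK.
by move/mulmx1_unit => [].
Qed.

Lemma dot_skew n (A : 'M[R]_n) (u v : 'rV[R]_n) :
  A^T = - A -> dot (u *m A) v = - dot u (v *m A).
Proof. by move=> AT; rewrite /dot trmx_mul AT mulNmx mulmxN mulmxA [X in - X]mxE opprK. Qed.

Lemma dot_skew0 n (A : 'M[R]_n) (u : 'rV[R]_n) : A^T = - A -> dot (u *m A) u = 0.
Proof. by move=> AT; have := dot_skew u u AT; rewrite (dotC u) => ?; lra. Qed.

Lemma dot_complex n (J : 'M[R]_n) (u v : 'rV[R]_n) :
  complex_structure J -> dot (u *m J) (v *m J) = dot u v.
Proof.
by move=> [JT JJ]; rewrite (dot_skew _ _ JT) -mulmxA JJ mulmxN mulmx1 dotNr opprK.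
Qed.

(** One step of symplectic Gram-Schmidt: a hyperbolic pair u, v is split off, and its symplectic
    orthogonal is a complement. *)
Lemma symplectic_split q (Om : 'M[R]_(2 + q)) : Om^T = - Om -> Om \in unitmx ->
  exists (T : 'M[R]_(2 + q)) (Om' : 'M[R]_q),
    [/\ T \in unitmx, Om'^T = - Om', Om' \in unitmx &
        T *m Om *m T^T = block_mx J2 0 0 Om'].
Proof.
move=> OmT uOm; pose u : 'rV[R]_(2 + q) := delta_mx ord0 ord0.
(* Chosen so that [u *m Om *m v^T] becomes [u *m u^T], which is 1. *)
pose v := u *m (invmx Om)^T.
have uu : dot u u = 1.
  by rewrite /dot trmx_delta mul_delta_mx mxE !eqxx.
have uOv : dot (u *m Om) v = 1.
  by rewrite /dot trmx_mul trmxK mulmxA mulmxK.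
pose C : 'M[R]_(1 + 1, 2 + q) := col_mx u v.
have COC : C *m Om *m C^T = J2.
  rewrite mul_col_mx tr_col_mx mul_col_row !dot_mx uOv !dot_skew0 //.
  by rewrite dot_skew // dotC uOv !raddf0 raddfN.
have rk : \rank (Om *m C^T) = 2.
  apply/eqP; rewrite eqn_leq rank_leq_col /=.
  have : \rank J2 = 2 by apply: mxrank_unit; apply: complex_structure_unit J2_complex.
  by rewrite -COC -mulmxA => <-; apply: mxrankM_maxr.
have rkK : \rank (kermx (Om *m C^T)) = q by rewrite mxrank_ker rk addKn.
have [K fK eK] := row_base_of_rank rkK.
have KOC : K *m Om *m C^T = 0.
  by rewrite -mulmxA; apply/sub_kermxP; rewrite eK.
have COK : C *m Om *m K^T = 0.
  apply: trmx_inj; rewrite !trmx_mul trmxK OmT trmx0 mulNmx mulmxN.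
  by rewrite mulmxA KOC oppr0.
pose T : 'M[R]_(2 + q) := col_mx C K.
have TOT : T *m Om *m T^T = block_mx J2 0 0 (K *m Om *m K^T).
  by rewrite mul_col_mx tr_col_mx mul_col_row COC COK KOC.
have uT : T \in unitmx.
  (* If x T = 0, the [J2] block of the transformed form kills the first part of x, and independence
     of the rows of [K] the second. *)
  rewrite -row_free_unit -kermx_eq0; apply/rowV0P => x /sub_kermxP.
  rewrite -[x]hsubmxK => xT.
  have : row_mx (lsubmx x) (rsubmx x) *m (T *m Om *m T^T) = 0.
    by rewrite !mulmxA xT !mul0mx.
  rewrite TOT mul_row_block !mulmx0 addr0 -[RHS](@row_mx0 _ 1 2 q).
  move=> /eq_row_mx[xJ _].
  have x10 : lsubmx x = 0.
    by rewrite -[LHS](mulmxK (complex_structure_unit J2_complex)) xJ mul0mx.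
  move/eqP: xT; rewrite mul_row_col x10 mul0mx add0r mulmx_free_eq0 // => /eqP->.
  by rewrite row_mx0.
exists T, (K *m Om *m K^T); split=> //.
  by rewrite !trmx_mul trmxK OmT mulNmx mulmxN mulmxA.
have : T *m Om *m T^T \in unitmx by rewrite !unitmx_mul uT uOm unitmx_tr.
by rewrite TOT unitmxE det_ublock unitrM => /andP[].
Qed.

Lemma congr_block m n (T : 'M[R]_n) (A : 'M[R]_m) (B : 'M[R]_n) :
  block_mx 1%:M 0 0 T *m block_mx A 0 0 B *m (block_mx 1%:M 0 0 T)^T =
  block_mx A 0 0 (T *m B *m T^T).
Proof.
rewrite tr_block_mx !mulmx_block trmx1 !trmx0.
by rewrite !mul0mx !mulmx0 !mul1mx !mulmx1 !addr0 !add0r !mul0mx.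
Qed.

Lemma unit_block1 m n (T : 'M[R]_n) :
  T \in unitmx -> block_mx (1%:M : 'M[R]_m) 0 0 T \in unitmx.
Proof. by rewrite !unitmxE det_ublock det1 mul1r. Qed.

Lemma complex_structure_block m n (J : 'M[R]_m) (J' : 'M[R]_n) :
  complex_structure J -> complex_structure J' ->
  complex_structure (block_mx J 0 0 J').
Proof.
move=> [JT JJ] [J'T J'J].
split; first by rewrite tr_block_mx !trmx0 JT J'T opp_block_mx !oppr0.
rewrite mulmx_block !mulmx0 !mul0mx !addr0 add0r JJ J'J.
by rewrite [in RHS]scalar_mx_block opp_block_mx !oppr0.
Qed.

Lemma symplectic_normal_form k (Om : 'M[R]_(k.*2)) :
  Om^T = - Om -> Om \in unitmx ->
  exists2 T : 'M[R]_(k.*2), T \in unitmx & complex_structure (T *m Om *m T^T).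
Proof.
elim: k Om => [|k IH] Om OmT uOm.
  by exists 1%:M; [exact: unitmx1|split; apply/matrixP => -[]].
have [T [Om' [uT Om'T uOm' TOT]]] := @symplectic_split k.*2 Om OmT uOm.
have [T' uT' [JT JJ]] := IH _ Om'T uOm'.
exists ((block_mx (1%:M : 'M[R]_2) 0 0 T' : 'M[R]_(2 + k.*2)) *m T).
  by rewrite unitmx_mul uT andbT; exact: (unit_block1 2 uT').
have -> : (block_mx (1%:M : 'M[R]_2) 0 0 T' : 'M[R]_(2 + k.*2)) *m T *m Om *m
    ((block_mx (1%:M : 'M[R]_2) 0 0 T' : 'M[R]_(2 + k.*2)) *m T)^T =
    block_mx J2 0 0 (T' *m Om' *m T'^T).
  by rewrite trmx_mul -congr_block -TOT !mulmxA.
exact: complex_structure_block J2_complex (conj JT JJ).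
Qed.

(** The minus sign gives the Hermitian form opposite signs on C and C^(n-1), so that (1, s) is null
    for unit s. It comes from normalising the opposite of the complementary form. *)
Lemma symplectic_complex_form k (Om : 'M[R]_(2 + k.*2)) :
  Om^T = - Om -> Om \in unitmx ->
  exists (T : 'M[R]_(2 + k.*2)) (J : 'M[R]_(k.*2)),
    [/\ T \in unitmx, complex_structure J & T *m Om *m T^T = block_mx J2 0 0 (- J)].
Proof.
move=> OmT uOm; have [T [Om' [uT Om'T uOm' TOT]]] := symplectic_split OmT uOm.
have [||T' uT' cJ] := @symplectic_normal_form k (- Om').
- by rewrite linearN /= Om'T.
- by rewrite -scaleN1r unitmxZ // unitrN1.
exists (block_mx 1%:M 0 0 T' *m T), (T' *m (- Om') *m T'^T); split=> //.
  by rewrite unitmx_mul uT unit_block1.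
rewrite mulmxN mulNmx opprK -congr_block -TOT trmx_mul !mulmxA //.
Qed.
End Symplectic.

(** * Null complex lines and isotropic real planes *)

Section LightPlanes.
Context {R : rcfType}.

(* The rows are a real basis (1, s), (i, i s) of the complex line spanned by (1, s),
   where i acts on R^q by J. *)
Definition light_frame q (J : 'M[R]_q) (s : 'rV[R]_q) : 'M[R]_(1 + 1, 2 + q) :=
  row_mx 1%:M (col_mx s (s *m J)).

Lemma row_free_light_frame q (J : 'M[R]_q) s (T : 'M[R]_(2 + q)) :
  T \in unitmx -> row_free (light_frame J s *m T).
Proof.
move=> uT; apply/row_freeP; exists (invmx T *m col_mx 1%:M 0).
by rewrite -mulmxA mulKVmx // mul_row_col mulmx1 mulmx0 addr0.
Qed.

(** The right-hand side is the real matrix of a complex number: up to a power of i and conjugation,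
    the Hermitian product of (1, s) and (1, t). *)
Lemma light_frame_form q (J : 'M[R]_q) s t : complex_structure J ->
  light_frame J s *m block_mx J2 0 0 (- J) *m (light_frame J t)^T =
  block_mx (- dot (s *m J) t)%:M (1 - dot s t)%:M
           (dot s t - 1)%:M (- dot (s *m J) t)%:M.
Proof.
move=> cJ; have [JT JJ] := cJ.
rewrite mul_row_block !mulmx0 addr0 add0r mul1mx tr_row_mx mul_row_col trmx1 mulmx1.
rewrite mulmxN mulNmx mul_col_mx tr_col_mx mul_col_row !dot_mx.
have -> : dot (s *m J) (t *m J) = dot s t by exact: dot_complex.
have -> : dot (s *m J *m J) t = - dot s t.
  by rewrite -mulmxA JJ mulmxN mulmx1 dotNl.
have -> : dot (s *m J *m J) (t *m J) = dot (s *m J) t by exact: dot_complex.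
rewrite opp_block_mx /J2 add_block_mx; congr block_mx.
all: by apply/matrixP => i j; rewrite !ord1 !mxE !eqxx /=; ring.
Qed.

Lemma rotation_unit (a b : R) : (a != 0) || (b != 0) ->
  block_mx a%:M b%:M (- b)%:M a%:M \in @unitmx R (1 + 1).
Proof.
move=> ab; set M := block_mx _ _ _ _.
have MM : M *m M^T = (a ^+ 2 + b ^+ 2)%:M.
  rewrite tr_block_mx mulmx_block !tr_scalar_mx -!scalar_mxM -!raddfD /=.
  by rewrite (@scalar_mx_block _ 1 1); congr block_mx; apply/matrixP => i j;
    rewrite !ord1 !mxE; ring.
have : M *m M^T \in unitmx.
  rewrite MM unitmxE det_scalar unitfE expf_neq0 //.
  by rewrite paddr_eq0 ?sqr_ge0 // !sqrf_eq0 negb_and.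
by rewrite unitmx_mul => /andP[].
Qed.

Lemma light_frame_form_unit q (J : 'M[R]_q) s t : complex_structure J ->
  dot s s = 1 -> dot t t = 1 -> s <> t ->
  light_frame J s *m block_mx J2 0 0 (- J) *m (light_frame J t)^T \in unitmx.
Proof.
move=> cJ ss tt st; rewrite light_frame_form // -(opprB 1 (dot s t)).
apply: rotation_unit; apply/orP; right; rewrite subr_eq0 eq_sym; apply/eqP.
by move=> st1; apply: st; exact: dot_unit_eq.
Qed.

Lemma light_frame_form0 q (J : 'M[R]_q) s : complex_structure J -> dot s s = 1 ->
  light_frame J s *m block_mx J2 0 0 (- J) *m (light_frame J s)^T = 0.
Proof.
move=> cJ ss; have [JT _] := cJ; rewrite light_frame_form // ss dot_skew0 // oppr0 subrr.
by rewrite raddf0 block_mx_const.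
Qed.

Lemma exists_perp m n (A : 'M[R]_(n, m)) : (m < n)%N ->
  exists2 e : 'rV[R]_n, e != 0 & e *m A = 0.
Proof.
move=> mn; have : kermx A != 0.
  rewrite -mxrank_eq0 mxrank_ker subn_eq0 -ltnNge.
  exact: leq_ltn_trans (rank_leq_col A) mn.
by case/rowV0Pn => e /sub_kermxP eA e0; exists e.
Qed.

(** Orthogonality to the complex line amounts to two real equations, prescribing the products of s
    with a and a J. The solution [s0] in the span of a, a J has squared length |b|^2 / |a|^2 <= 1
    and is lengthened by a vector orthogonal to that span. For q <= 2 such a vector need not exist,
    hence the equality hypothesis. *)
Lemma exists_light_frame_perp q (J : 'M[R]_q) (a : 'rV[R]_q) (b : 'rV[R]_(1 + 1)) :
  complex_structure J -> (0 < q)%N -> dot b b <= dot a a ->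
  ((q <= 2)%N -> dot b b = dot a a) ->
  exists2 s, dot s s = 1 &
    row_mx b a *m block_mx J2 0 0 (- J) *m (light_frame J s)^T = 0.
Proof.
move=> cJ q0 ba ba2; have [JT _] := cJ.
suff [s ss [as_ aJs]] : exists2 s, dot s s = 1 &
    dot a s = lsubmx b 0 0 /\ dot (a *m J) s = - rsubmx b 0 0.
  exists s => //; rewrite mul_row_block !mulmx0 addr0 add0r tr_row_mx mul_row_col.
  rewrite trmx1 mulmx1 tr_col_mx mulmxN mulNmx mul_mx_row !dot_mx.
  rewrite dot_complex // as_ aJs -[b in b *m J2]hsubmxK mul_row_block !mulmx0.
  rewrite mulmxN !mulmx1 addr0 add0r opp_row_mx add_row_mx.
  rewrite !raddfN /= -!mx11_scalar opprK addNr subrr; exact: row_mx0.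
set b0 := lsubmx b 0 0; set b1 := rsubmx b 0 0.
have bb : dot b b = b0 ^+ 2 + b1 ^+ 2.
  rewrite -[b]hsubmxK /dot tr_row_mx mul_row_col mxE -/(dot _ _) -/(dot _ _).
  by rewrite !dotE !big_ord1.
(* Here b vanishes too, and any unit vector serves. *)
have [a0|a0] := eqVneq a 0.
  have := ba; rewrite bb {1}a0 /dot mul0mx mxE => b00.
  have [b00' b10] : b0 = 0 /\ b1 = 0.
    have := sqr_ge0 b0; have := sqr_ge0 b1 => h1 h0.
    by split; apply/eqP; rewrite -sqrf_eq0; apply/eqP; lra.
  exists (delta_mx 0 (Ordinal q0)).
    by rewrite /dot trmx_delta mul_delta_mx mxE !eqxx.
  by rewrite b00' b10 a0 /dot !mul0mx !mxE oppr0.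
have A0 : dot a a != 0 by rewrite dot_eq0.
have Agt0 : 0 < dot a a by rewrite lt_def A0 dot_ge0.
have aJa : dot (a *m J) a = 0 by exact: dot_skew0.
have aaJ : dot a (a *m J) = 0 by rewrite dotC.
have aJaJ : dot (a *m J) (a *m J) = dot a a by exact: dot_complex.
pose s0 := (b0 / dot a a) *: a - (b1 / dot a a) *: (a *m J).
have s0s0 : dot s0 s0 = dot b b / dot a a.
  rewrite /s0 !dot_lin aJa aaJ aJaJ bb; field => //.
have as0 : dot a s0 = b0 by rewrite /s0 !dot_lin aaJ; field.
have aJs0 : dot (a *m J) s0 = - b1 by rewrite /s0 !dot_lin aJa aJaJ; field.
have [q2|q2] := leqP q 2.
  by exists s0; rewrite // s0s0 ba2 // divff.
have [e e0] := @exists_perp (1 + 1) q (row_mx a^T (a *m J)^T) q2.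
rewrite mul_mx_row -[RHS](@row_mx0 _ 1 1 1) => /eq_row_mx[ea eaJ].
have {}ea : dot e a = 0 by rewrite /dot ea mxE.
have {}eaJ : dot e (a *m J) = 0 by rewrite /dot eaJ mxE.
have E0 : dot e e != 0 by rewrite dot_eq0.
have Egt0 : 0 < dot e e by rewrite lt_def E0 dot_ge0.
have es0 : dot e s0 = 0 by rewrite /s0 !dot_lin ea eaJ; ring.
clearbody s0.
pose c := Num.sqrt ((1 - dot s0 s0) / dot e e).
have cc : c ^+ 2 = (1 - dot s0 s0) / dot e e.
  rewrite sqr_sqrtr // divr_ge0 ?(ltW Egt0) // subr_ge0 s0s0 ler_pdivrMr // mul1r //.
exists (s0 + c *: e).
  rewrite !dot_lin es0 (dotC s0 e) es0.
  transitivity (dot s0 s0 + c ^+ 2 * dot e e); first by ring.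
  by rewrite cc; field.
by rewrite !dot_lin as0 aJs0 (dotC a e) (dotC (a *m J) e) ea eaJ mulr0 !addr0.
Qed.

(** On t x + y the quadratic form is p t^2 + 2 c t + r with p r <= 0, so for p <> 0 it has a real
    root. *)
Lemma exists_null_vector m (G : 'M[R]_m) (x y : 'rV[R]_m) : G^T = G ->
  x != 0 -> y != 0 -> 0 <= dot (x *m G) x -> dot (y *m G) y <= 0 ->
  exists2 z, z != 0 & dot (z *m G) z = 0.
Proof.
move=> GT x0 y0; set p := dot _ _; set r := dot _ _ => p0 r0.
have [pe|pn] := eqVneq p 0; first by exists x.
have pgt : 0 < p by rewrite lt_def pn.
pose c := dot (x *m G) y.
have cE : dot (y *m G) x = c by rewrite dotC /c /dot trmx_mul GT mulmxA.
pose d := Num.sqrt (c ^+ 2 - p * r).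
have dd : d ^+ 2 = c ^+ 2 - p * r.
  by rewrite sqr_sqrtr // subr_ge0 (le_trans _ (sqr_ge0 c)) // pmulr_rle0.
(* The root t = (d - c) / p, with denominators cleared. *)
exists ((d - c) *: x + p *: y).
  (* Otherwise y = k x with k <> 0, and r = k^2 p would be positive. *)
  apply/eqP => z0; move: r0.
  have yE : y = (- (d - c) / p) *: x.
    have /(canRL (scalerK pn)) -> : p *: y = - (d - c) *: x.
      by apply/eqP; rewrite -subr_eq0 -scaleNr opprK addrC z0.
    by rewrite scalerA mulrC.
  move: y0; rewrite yE scaler_eq0 (negPf x0) orbF.
  rewrite /r yE -scalemxAl !dot_lin -/p mulrA -expr2 pmulr_lle0 // => k1 k2.
  by move: k1; rewrite -sqrf_eq0 eq_le k2 sqr_ge0.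
rewrite mulmxDl -!scalemxAl !dot_lin -/p -/r cE -/c.
transitivity (p * (d ^+ 2 - c ^+ 2 + p * r)); first by ring.
by rewrite dd; ring.
Qed.

(* If X is invertible, Z = X^-1 Y satisfies Z J' Z^T = J, so the rows z0, z1 of Z have
   (z0 J', z1) = +1 or -1 and cannot both be shorter than 1. *)
Lemma exists_vector_dot_le q (X J : 'M[R]_2) (Y : 'M[R]_(2, q)) (J' : 'M[R]_q) :
  complex_structure J -> complex_structure J' ->
  X *m J *m X^T = Y *m J' *m Y^T ->
  exists2 x : 'rV[R]_2, x != 0 & dot (x *m X) (x *m X) <= dot (x *m Y) (x *m Y).
Proof.
move=> cJ cJ' XY; have [JT JJ] := cJ.
have [uX|] := boolP (X \in unitmx); last first.
  (* For singular X, a kernel vector makes the left side 0. *)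
  rewrite -row_free_unit -kermx_eq0 => /rowV0Pn[x /sub_kermxP xX x0].
  by exists x => //; rewrite xX {1}/dot mul0mx mxE dot_ge0.
pose Z := invmx X *m Y; pose z i := row i Z.
have ZJZ : Z *m J' *m Z^T = J.
  rewrite trmx_mul !mulmxA -(mulmxA (invmx X)) -(mulmxA (invmx X)) -XY.
  by rewrite !mulmxA mulVmx // mul1mx -mulmxA -trmx_mul mulVmx // trmx1 mulmx1.
have Jsk i j : J i j = - J j i by have /matrixP/(_ j i) := JT; rewrite !mxE.
have Jii i : J i i = 0 by have := Jsk i i => ?; lra.
have J01 : J 0 1 ^+ 2 = 1.
  have /matrixP/(_ 0 0) := JJ; rewrite !mxE !big_ord_recl big_ord0 Jii /=.
  have -> : lift ord0 ord0 = 1 :> 'I_2 by apply/val_inj.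
  by rewrite (Jsk 1 0) => ?; rewrite expr2; lra.
have zJz : dot (z 0 *m J') (z 1) = J 0 1.
  rewrite -[in RHS]ZJZ /dot /z -row_mul !mxE.
  by apply: eq_bigr => k _; rewrite !mxE.
have zi i : dot (delta_mx 0 i *m invmx X *m X) (delta_mx 0 i *m invmx X *m X) = 1.
  by rewrite mulmxKV // /dot trmx_delta mul_delta_mx mxE !eqxx.
have xi0 i : delta_mx 0 i *m invmx X != 0 :> 'rV[R]_2.
  apply/eqP => x0; have := zi i; rewrite x0 /dot !mul0mx mxE => /eqP.
  by rewrite eq_sym oner_eq0.
have ziE i : delta_mx 0 i *m invmx X *m Y = z i by rewrite -mulmxA -rowE.
(* Since [J 0 1] is a sign equal to the product of [z 0 *m J'] and [z 1], expanding this square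
   gives |z0|^2 + |z1|^2 >= 2. *)
have : 0 <= dot (z 0 *m J' - J 0 1 *: z 1) (z 0 *m J' - J 0 1 *: z 1).
  exact: dot_ge0.
rewrite !dot_lin dot_complex // zJz (dotC (z 1)) zJz => h.
have {}h : 2 <= dot (z 0) (z 0) + dot (z 1) (z 1).
  suff : 0 <= dot (z 0) (z 0) - 2 * J 0 1 ^+ 2 + J 0 1 ^+ 2 * dot (z 1) (z 1).
    by rewrite J01; lra.
  by apply: le_trans h _; rewrite le_eqVlt; apply/orP; left; apply/eqP; ring.
have [h0|h0] := lerP 1 (dot (z 0) (z 0)).
  by exists (delta_mx 0 0 *m invmx X) => //; rewrite zi ziE.
by exists (delta_mx 0 1 *m invmx X) => //; rewrite zi ziE; lra.
Qed.

(** For q = 2 the roles of X and Y can be exchanged, giving a second vector with the reverse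
    inequality; the difference of the two squared lengths then has a null vector. *)
Lemma exists_light_vector q (X : 'M[R]_2) (Y : 'M[R]_(2, q)) (J : 'M[R]_q) :
  complex_structure J -> X *m J2 *m X^T = Y *m J *m Y^T ->
  exists x : 'rV[R]_2, [/\ x != 0, dot (x *m X) (x *m X) <= dot (x *m Y) (x *m Y)
    & q = 2 -> dot (x *m X) (x *m X) = dot (x *m Y) (x *m Y)].
Proof.
move=> cJ XY; have [x x0 xXY] := exists_vector_dot_le J2_complex cJ XY.
have [q2|/eqP q2] := eqVneq q 2; last by exists x.
subst q; have [y y0 yXY] := exists_vector_dot_le cJ J2_complex (esym XY).
pose G := Y *m Y^T - X *m X^T.
have GE z : dot (z *m G) z = dot (z *m Y) (z *m Y) - dot (z *m X) (z *m X).
  by rewrite /G mulmxBr /dot !trmx_mul mulmxBl !mulmxA !mxE.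
have GT : G^T = G by rewrite /G linearB /= !trmx_mul !trmxK.
have [||z z0 zG] := exists_null_vector GT x0 y0; first by rewrite GE subr_ge0.
  by rewrite GE subr_le0.
exists z; have {}zG : dot (z *m X) (z *m X) = dot (z *m Y) (z *m Y).
  by apply/esym/eqP; rewrite -subr_eq0 -GE zG.
by split=> //; rewrite zG.
Qed.
End LightPlanes.

(** * Complex lines of C^2 parametrised by the 2-sphere *)

Section ComplexLines.
Context {R : realFieldType}.

(* The real form of the Hermitian Pauli combination
   [[x0, x1 + i x2], [x1 - i x2, -x0]]. *)
Definition pauli (x : 'rV[R]_3) : 'M[R]_(2 + 2) :=
  let c := x ord0 ord0 in
  let a := x ord0 (lift ord0 ord0) in
  let b := x ord0 (lift ord0 (lift ord0 ord0)) in
  block_mx c%:M (a%:M + b *: J2) (a%:M - b *: J2) (- c)%:M.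

Lemma dot3E (x y : 'rV[R]_3) : dot x y = x ord0 ord0 * y ord0 ord0 +
  (x ord0 (lift ord0 ord0) * y ord0 (lift ord0 ord0) +
   x ord0 (lift ord0 (lift ord0 ord0)) * y ord0 (lift ord0 (lift ord0 ord0))).
Proof. by rewrite dotE !big_ord_recl big_ord0 addr0. Qed.

Lemma pauli_sym x : (pauli x)^T = pauli x.
Proof.
have [J2T _] := @J2_complex R.
rewrite /pauli tr_block_mx !tr_scalar_mx linearB linearD /= !linearZ /= J2T tr_scalar_mx.
by rewrite ?scalerN opprK.
Qed.

Lemma pauliB x y : pauli (x - y) = pauli x - pauli y.
Proof.
rewrite /pauli opp_block_mx add_block_mx !mxE; move: J2 => J.
congr block_mx; apply/matrixP => i j; rewrite !mxE; case: (i == j) => /=; ring.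
Qed.

(** The Clifford relation: [pauli x] is an involution for unit x, and [pauli (x - y)] is invertible
    for x <> y. *)
Lemma pauli_sqr x : pauli x *m pauli x = (dot x x)%:M.
Proof.
have [_ JJ] := @J2_complex R; rewrite dot3E /pauli.
move: (x _ _) (x _ _) (x _ _) => c a b.
have aN : (- c)%:M = - c%:M :> 'M[R]_2 by rewrite raddfN.
have mulJ (p q r t : R) : (p%:M + q *: J2) *m (r%:M + t *: J2) =
    (p * r - q * t)%:M + (p * t + q * r) *: J2.
  rewrite mulmxDr !mulmxDl -!scalemxAl -!scalemxAr JJ -!scalar_mxM.
  rewrite mul_scalar_mx mul_mx_scalar; move: J2 => J.
  apply/matrixP => i j; rewrite !mxE; case: (i == j) => /=; ring.
rewrite -!scaleNr mulmx_block (@scalar_mx_block _ 2 2); congr block_mx.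
- rewrite mulJ -scalar_mxM; move: J2 => J.
  apply/matrixP => i j; rewrite !mxE; case: (i == j) => /=; ring.
- by rewrite mul_scalar_mx mul_mx_scalar scaleNr subrr.
- by rewrite mul_scalar_mx mul_mx_scalar !scaleNr subrr.
- rewrite mulJ -scalar_mxM; move: J2 => J.
  apply/matrixP => i j; rewrite !mxE; case: (i == j) => /=; ring.
Qed.

(** For unit x, the projection onto the +1 eigenspace of [pauli x], a complex line of C^2. *)
Definition line_proj (x : 'rV[R]_3) : 'M[R]_(2 + 2) := 2^-1 *: (1%:M + pauli x).

Lemma line_proj_fix x (a : 'rV[R]_(2 + 2)) :
  (a *m line_proj x == a) = (a *m pauli x == a).
Proof.
rewrite /line_proj -scalemxAr mulmxDr mulmx1.
rewrite -(inj_eq (scalerI (_ : 2 != 0 :> R))) ?pnatr_eq0 //.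
by rewrite scalerA divff ?pnatr_eq0 // scale1r scaler_nat mulr2n (inj_eq (addrI a)).
Qed.

Lemma line_proj_sym x : (line_proj x)^T = line_proj x.
Proof. by rewrite /line_proj linearZ /= linearD /= trmx1 pauli_sym. Qed.

Lemma line_proj_idem x : dot x x = 1 -> line_proj x *m line_proj x = line_proj x.
Proof.
move=> xx; rewrite /line_proj -scalemxAl -scalemxAr mulmxDl !mulmxDr !mul1mx mulmx1.
rewrite pauli_sqr xx (addrC (pauli x)) -mulr2n.
by rewrite -(scaler_nat 2 (1%:M + pauli x)) (scalerA 2^-1 2) mulVf ?pnatr_eq0 // scale1r.
Qed.

Lemma line_proj_trace x : \tr (line_proj x) = 2.
Proof.
rewrite /line_proj linearZ /= linearD /= mxtrace1 /pauli mxtrace_block.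
rewrite !mxtrace_scalar mulNrn subrr addr0; by field.
Qed.

(** A common +1 eigenvector is killed by [pauli (x - y)], whose square is the nonzero scalar |x -
    y|^2. *)
Lemma line_proj_cap x y (a : 'rV[R]_(2 + 2)) : x <> y ->
  a *m line_proj x = a -> a *m line_proj y = a -> a = 0.
Proof.
move=> xy /eqP; rewrite line_proj_fix => /eqP ax /eqP; rewrite line_proj_fix => /eqP ay.
have axy : a *m pauli (x - y) = 0 by rewrite pauliB mulmxBr ax ay subrr.
have : a *m pauli (x - y) *m pauli (x - y) = 0 by rewrite axy mul0mx.
rewrite -mulmxA pauli_sqr mul_mx_scalar => /eqP; rewrite scaler_eq0 dot_eq0 subr_eq0.
by case/orP=> /eqP.
Qed.

(* Expansion of v in the orthogonal basis (u, u J2). *)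
Lemma J2_expand (u v : 'rV[R]_(1 + 1)) :
  dot u v *: u + dot (u *m J2) v *: (u *m J2) = dot u u *: v.
Proof.
rewrite -[u]hsubmxK -[v]hsubmxK [lsubmx u]mx11_scalar [rsubmx u]mx11_scalar.
rewrite [lsubmx v]mx11_scalar [rsubmx v]mx11_scalar.
move: (_ 0 0) (_ 0 0) (_ 0 0) (_ 0 0) => a b c d.
rewrite /J2 mul_row_block !mulmx0 add0r addr0 mulmx1 mulmxN mulmx1.
rewrite /dot !tr_row_mx !mul_row_col !tr_scalar_mx !scale_row_mx add_row_mx.
congr row_mx; apply/matrixP => i j; rewrite !ord1 !mxE !big_ord1 !mxE !eqxx; ring.
Qed.

Lemma exists_line (a : 'rV[R]_(2 + 2)) : a != 0 ->
  exists2 x, dot x x = 1 & a *m line_proj x = a.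
Proof.
move=> a0; pose u := lsubmx a; pose v := rsubmx a.
have aE : a = row_mx u v by rewrite hsubmxK.
have D : dot a a = dot u u + dot v v.
  by rewrite aE /dot tr_row_mx mul_row_col mxE.
have D0 : dot u u + dot v v != 0 by rewrite -D dot_eq0.
(* The Hopf map: the point of the sphere attached to the complex line through (u, v). *)
pose x : 'rV[R]_3 := (dot u u + dot v v)^-1 *:
  \row_i [:: dot u u - dot v v; 2 * dot u v; 2 * dot (u *m J2) v]`_i.
have ax : a *m pauli x = a.
  have [JT _] := @J2_complex R; have uv := J2_expand u v; have vu := J2_expand v u.
  rewrite aE /pauli !mxE /= mul_row_block; congr row_mx.
    transitivity ((dot u u + dot v v)^-1 *: ((dot u u - dot v v) *: u +
        2 *: (dot v u *: v + dot (v *m J2) u *: (v *m J2)))).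
      rewrite (dot_skew v u JT) [dot v (u *m J2)]dotC (dotC v u).
      rewrite mulmxBr -scalemxAr !mul_mx_scalar; move: (v *m J2) => vJ.
      by apply/rowP => i; rewrite !mxE; ring.
    by rewrite vu scalerA -scalerDl scalerA [X in X *: _ = _](_ : _ = 1) ?scale1r //; field.
  transitivity ((dot u u + dot v v)^-1 *: ((dot v v - dot u u) *: v +
      2 *: (dot u v *: u + dot (u *m J2) v *: (u *m J2)))).
    rewrite mulmxDr -scalemxAr !mul_mx_scalar; move: (u *m J2) => uJ.
    by apply/rowP => i; rewrite !mxE; ring.
  by rewrite uv scalerA -scalerDl scalerA [X in X *: _ = _](_ : _ = 1) ?scale1r //; field.
exists x; last by apply/eqP; rewrite line_proj_fix ax.
(* |x| = 1 without computing it: [pauli x] fixes a, and its square multiplies a by |x|^2. *)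
have : (dot x x - 1) *: a == 0.
  by rewrite scalerBl scale1r -mul_mx_scalar -pauli_sqr mulmxA !ax subrr.
by rewrite scaler_eq0 (negPf a0) orbF subr_eq0 => /eqP.
Qed.
End ComplexLines.

(** * Continuity of matrix-valued maps *)

Lemma continuous_mxP (X : topologicalType) (R : realType) m n (F : X -> 'M[R]_(m, n)) :
  (forall i j, continuous (fun x => F x i j)) -> continuous F.
Proof.
move=> Fc x A [P PF PA].
suff : \forall y \near x, forall i j, P i j (F y i j) by apply: filterS => y; exact: PA.
by apply: filter_forall => i; apply: filter_forall => j; exact/Fc/PF.
Qed.

Section ContinuousMatrices.
Context {X : topologicalType} {R : realType}.

Lemma continuous_mx_entry m n (F : X -> 'M[R]_(m, n)) i j :
  continuous F -> continuous (fun x => F x i j).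
Proof.
by move=> Fc x; apply: (continuous_comp (g := fun M : 'M[R]_(m, n) => M i j));
  [exact: Fc|exact: coord_continuous].
Qed.

Lemma continuous_bigsum (I : Type) (r : seq I) (P : pred I) (F : I -> X -> R) :
  (forall i, continuous (F i)) -> continuous (fun x => \sum_(i <- r | P i) F i x).
Proof.
move=> Fc; elim: r => [|i r IH].
  by under eq_fun do rewrite big_nil; move=> x; exact: cst_continuous.
under eq_fun do rewrite big_cons; case: (P i) => //.
by move=> x; apply: continuousD; [exact: Fc|exact: IH].
Qed.

Lemma continuous_bigprod (I : Type) (r : seq I) (P : pred I) (F : I -> X -> R) :
  (forall i, continuous (F i)) -> continuous (fun x => \prod_(i <- r | P i) F i x).
Proof.
move=> Fc; elim: r => [|i r IH].
  by under eq_fun do rewrite big_nil; move=> x; exact: cst_continuous.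
under eq_fun do rewrite big_cons; case: (P i) => //.
by move=> x; apply: continuousM; [exact: Fc|exact: IH].
Qed.

Lemma continuous_mulr (F G : X -> R) :
  continuous F -> continuous G -> continuous (fun x => F x * G x).
Proof. by move=> Fc Gc x; apply: continuousM; [exact: Fc|exact: Gc]. Qed.

Lemma continuous_mulrl (c : R) (F : X -> R) :
  continuous F -> continuous (fun x => c * F x).
Proof. by move=> Fc x; apply: continuousM; [exact: cst_continuous|exact: Fc]. Qed.

Lemma continuous_mulmx m n p (F : X -> 'M[R]_(m, n)) (G : X -> 'M[R]_(n, p)) :
  continuous F -> continuous G -> continuous (fun x => F x *m G x).
Proof.
move=> Fc Gc; apply: continuous_mxP => i j; under eq_fun do rewrite mxE.
apply: continuous_bigsum => k x.
by apply: continuousM; exact: continuous_mx_entry.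
Qed.

Lemma continuous_trmx m n (F : X -> 'M[R]_(m, n)) :
  continuous F -> continuous (fun x => (F x)^T).
Proof.
move=> Fc; apply: continuous_mxP => i j; under eq_fun do rewrite mxE.
exact: continuous_mx_entry.
Qed.

Lemma continuous_det n (F : X -> 'M[R]_n) :
  continuous F -> continuous (fun x => \det (F x)).
Proof.
move=> Fc; under eq_fun do rewrite /determinant.
apply: continuous_bigsum => s /=.
apply: continuous_mulrl.
by apply: continuous_bigprod => i; exact: continuous_mx_entry.
Qed.

(** Invertibility at every point selects the adjugate formula in [invmx] and keeps the determinant
    away from 0. *)
Lemma continuous_invmx n (F : X -> 'M[R]_n) : (forall x, F x \in unitmx) ->
  continuous F -> continuous (fun x => invmx (F x)).
Proof.
move=> uF Fc; apply: continuous_mxP => i j.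
under eq_fun do rewrite /invmx uF !mxE.
apply: (@continuous_mulr (fun x => (\det (F x))^-1)).
  move=> x; apply: (@continuousV R X (fun x => \det (F x))).
    by rewrite -unitfE -unitmxE.
  exact: continuous_det.
apply: continuous_mulrl.
apply: continuous_det; apply: continuous_mxP => k l.
by under eq_fun do rewrite !mxE; exact: continuous_mx_entry.
Qed.

Lemma continuous_row_mx m n p (F : X -> 'M[R]_(m, n)) (G : X -> 'M[R]_(m, p)) :
  continuous F -> continuous G -> continuous (fun x => row_mx (F x) (G x)).
Proof.
move=> Fc Gc; apply: continuous_mxP => i j; under eq_fun do rewrite mxE.
by case: (fintype.split j) => k; exact: continuous_mx_entry.
Qed.

Lemma continuous_col_mx m n p (F : X -> 'M[R]_(m, n)) (G : X -> 'M[R]_(p, n)) :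
  continuous F -> continuous G -> continuous (fun x => col_mx (F x) (G x)).
Proof.
move=> Fc Gc; apply: continuous_mxP => i j; under eq_fun do rewrite mxE.
by case: (fintype.split i) => k; exact: continuous_mx_entry.
Qed.

Lemma continuous_block_mx m n p q (A : X -> 'M[R]_(m, n)) (B : X -> 'M[R]_(m, q))
    (C : X -> 'M[R]_(p, n)) (D : X -> 'M[R]_(p, q)) :
  continuous A -> continuous B -> continuous C -> continuous D ->
  continuous (fun x => block_mx (A x) (B x) (C x) (D x)).
Proof. by move=> *; apply: continuous_col_mx; exact: continuous_row_mx. Qed.

Lemma continuous_orthoproj m n (F : X -> 'M[R]_(m, n)) :
  (forall x, row_free (F x)) -> continuous F -> continuous (fun x => orthoproj (F x)).
Proof.
move=> fF Fc; have Ft := continuous_trmx Fc.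
apply: continuous_mulmx => //; apply: continuous_mulmx => //.
apply: continuous_invmx; last exact: continuous_mulmx.
by move=> x; exact: row_free_gram.
Qed.

End ContinuousMatrices.

(** * Compactness of spheres, embeddings and parametrised antipodal families *)

Lemma sphere_dot (R : realType) k (x : 'rV[R]_k.+1) : @sphere R k x <-> dot x x = 1.
Proof. by rewrite /sphere /= dotE; under eq_bigr do rewrite expr2. Qed.

Lemma sphere_compact (R : realType) k : compact (@sphere R k).
Proof.
apply: bounded_closed_compact.
  exists 1; split=> // M M1 x /= xS; apply: le_trans (ltW M1).
  rewrite [leLHS]/Num.norm /= mx_normrE; apply: bigmax_le => // -[i j] _ /=.
  (* Each squared coordinate is at most the whole sum 1, which bounds the max norm. *)
  rewrite ord1 -(@expr_le1 _ 2) // real_normK ?num_real // -xS (bigD1 j) //= lerDl.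
  by apply: sumr_ge0 => l _; rewrite sqr_ge0.
have -> : @sphere R k = (fun x : 'rV[R]_k.+1 => \sum_i x ord0 i ^+ 2) @^-1` [set 1] by [].
apply: preimage_closed; last exact: closed_eq.
move=> y _; move: y.
  apply: (@continuous_bigsum _ _ _ _ _ (fun i (x : 'rV[R]_k.+1) => x ord0 i ^+ 2)) => i.
under eq_fun do rewrite expr2.
by apply: (@continuous_mulr _ _ (fun x : 'rV[R]_k.+1 => x ord0 i)); exact: coord_continuous.
Qed.

Lemma homeomorphic_image (X : ptopologicalType) (Y : topologicalType)
    (A : set X) (f : X -> Y) : hausdorff_space Y -> compact A -> continuous f ->
  (forall x y, A x -> A y -> f x = f y -> x = y) -> homeomorphic (f @` A) A.
Proof.
(* [g] inverts [f] on the image; elsewhere it takes the default [point]. *)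
move=> hY cA fc finj; pose g y := xget point [set x | A x /\ f x = y].
have gP x : A x -> A (g (f x)) /\ f (g (f x)) = f x.
  by move=> Ax; apply: (@xgetPex _ point [set z | A z /\ f z = f x]); exists x.
have gK x : A x -> g (f x) = x by move=> Ax; have [? ?] := gP _ Ax; exact: finj.
exists g, f; split; last split; last exact: continuous_subspaceT.
  split=> [_ [x Ax <-]|x Ax|_ [x Ax <-]|x Ax]; first by have [] := gP _ Ax.
  - by exists x.
  - by have [] := gP _ Ax.
  - exact: gK.
apply/continuous_closedP => C cC; apply/closed_subspaceP.
(* On the image, the preimage of C under [g] is this set, which is compact and so closed in the
   Hausdorff target. *)
exists (f @` (A `&` C)).
  apply: compact_closed => //; apply: continuous_compact.
    exact: continuous_subspaceT.
  exact: compact_closedI.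
apply/seteqP; split=> y [].
  move=> [x [Ax Cx] <-] _; split; last by exists x.
  by change (C (g (f x))); rewrite gK.
move=> /[swap] -[x Ax <-] Cgx; split; last by exists x.
by exists x => //; split=> //; rewrite -(gK _ Ax).
Qed.

(** Injectivity follows from maximality: if f s = f t with s <> t, then f s would be antipodal to
    every member of the family, itself included. *)
Lemma maximally_antipodal_image (X Y : Type) (S : set X) (f : X -> Y)
    (F : set Y) (antip : Y -> Y -> Prop) :
  (forall s, S s -> F (f s)) ->
  (forall s t, S s -> S t -> s <> t -> antip (f s) (f t)) ->
  (forall y, F y -> exists2 s, S s & ~ antip y (f s)) ->
  maximally_antipodal F antip (f @` S) /\
  (forall s t, S s -> S t -> f s = f t -> s = t).
Proof.
move=> SF Santi Smax; split; first split; [|split|].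
- by move=> _ [s Ss <-]; exact: SF.
- by move=> _ _ [s Ss <-] [t St <-] st; apply: Santi => // est; apply: st; rewrite est.
- by move=> y /Smax[s Ss ys]; exists (f s) => //; exists s.
move=> s t Ss St fst; apply: contrapT => st.
have [u Su] := Smax _ (SF _ Ss).
have [<-|su] := pselect (s = u); last by case; exact: Santi.
by case; rewrite {2}fst; exact: Santi.
Qed.

(** * Spheres of flags and of isotropic planes *)

Section Antipodality.
Context {R : realType}.

Lemma complementary_cap m p N (U : 'M[R]_(m, N)) (W : 'M[R]_(p, N)) :
  (\rank U + \rank W = N)%N ->
  (forall x : 'rV[R]_N, (x <= U)%MS -> (x <= W)%MS -> x = 0) -> complementary U W.
Proof.
move=> rUW cap; have cap0 : (U :&: W)%MS = 0.
  apply/eqP/rowV0P => x; rewrite sub_capmx => /andP[]; exact: cap.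
split=> //; apply/eqmxP; rewrite submx1 sub1mx /row_full.
by have := mxrank_sum_cap U W; rewrite cap0 mxrank0 addn0 rUW => ->; rewrite eqxx.
Qed.

Lemma not_complementary m p N (U : 'M[R]_(m, N)) (W : 'M[R]_(p, N)) (x : 'rV[R]_N) :
  x != 0 -> (x <= U)%MS -> (x <= W)%MS -> ~ complementary U W.
Proof.
move=> x0 xU xW [_ cap0]; have : (x <= U :&: W)%MS by rewrite sub_capmx xU.
by rewrite cap0 submx0 (negPf x0).
Qed.

Lemma orthoproj_fixP N (P : 'M[R]_N) (x : 'rV[R]_N) :
  P *m P = P -> (x <= P)%MS -> x *m P = x.
Proof. by move=> PP /submxP[D ->]; rewrite -mulmxA PP. Qed.

(** The flag (l, l + R^p) with p = 2n - 4. For [p := m.*2] the size is convertible to [m.+2.*2], so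
    no cast occurs. *)
Definition line_flag p (x : 'rV[R]_3) : 'M[R]_(2 + 2 + p) * 'M[R]_(2 + 2 + p) :=
  (block_mx (line_proj x) 0 0 0, block_mx (line_proj x) 0 0 1%:M).

Lemma grass_block p (x : 'rV[R]_3) k (D : 'M[R]_p) : dot x x = 1 ->
  is_orthoproj D -> \tr D = k%:R ->
  grass (2 + k) (block_mx (line_proj x) 0 0 D : 'M[R]_(2 + 2 + p)).
Proof.
move=> xx [DD DT] trD; have PP : block_mx (line_proj x) 0 0 D *m block_mx (line_proj x) 0 0 D =
    block_mx (line_proj x) 0 0 D.
  by rewrite mulmx_block !mulmx0 !mul0mx !addr0 add0r line_proj_idem // DD.
split; first by split=> //; rewrite tr_block_mx !trmx0 line_proj_sym DT.
have := mxrank_idem_trace PP; rewrite mxtrace_block line_proj_trace trD -natrD.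
by move/eqP; rewrite eqr_nat => /eqP.
Qed.

Lemma line_flag_flag p (x : 'rV[R]_3) : dot x x = 1 ->
  [/\ grass 2 (line_flag p x).1, grass (2 + p) (line_flag p x).2 &
      ((line_flag p x).1 <= (line_flag p x).2)%MS].
Proof.
move=> xx; split.
- have := @grass_block p x 0 0 xx; rewrite addn0; apply; last by rewrite mxtrace0.
  by split; rewrite ?mul0mx ?trmx0.
- apply: grass_block => //; last by rewrite mxtrace1.
  by split; rewrite ?mulmx1 ?trmx1.
- apply/submxP; exists (line_flag p x).1.
  by rewrite mulmx_block !mulmx0 !mul0mx !addr0 line_proj_idem.
Qed.

(** A common vector has no R^p component, and its C^2 component lies on two distinct complex
    lines. *)
Lemma line_flag_antipodal p (x y : 'rV[R]_3) : dot x x = 1 -> dot y y = 1 -> x <> y ->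
  complementary (line_flag p x).1 (line_flag p y).2.
Proof.
move=> xx yy xy.
have [[[idx _] rx] _ _] := line_flag_flag p xx.
have [_ [[idy _] ry] _] := line_flag_flag p yy.
apply: complementary_cap; first by rewrite rx ry addnA.
move=> v /(orthoproj_fixP idx) + /(orthoproj_fixP idy).
rewrite -[v]hsubmxK !mul_row_block !mulmx0 !addr0 => /eq_row_mx[vx v0] /eq_row_mx[vy _].
by rewrite (line_proj_cap xy vx vy) -v0 row_mx0.
Qed.

Lemma exists_line_flag p (v : 'rV[R]_(2 + 2 + p)) :
  exists2 x, dot x x = 1 & (v <= (line_flag p x).2)%MS.
Proof.
have [x xx vx] : exists2 x, dot x x = 1 & lsubmx v *m line_proj x = lsubmx v.
  have [->|v0] := eqVneq (lsubmx v) 0; last exact: exists_line.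
  exists (delta_mx 0 0); last by rewrite mul0mx.
  by rewrite /dot trmx_delta mul_delta_mx mxE !eqxx.
exists x => //; apply/submxP; exists v.
by rewrite -[v in RHS]hsubmxK mul_row_block !mulmx0 addr0 add0r mulmx1 vx hsubmxK.
Qed.

Lemma continuous_line_flag p : continuous (@line_flag p).
Proof.
have c0 : continuous (@line_proj R).
  apply: continuous_mxP => i j; under eq_fun do rewrite mxE.
  apply: continuous_mulrl; under eq_fun do rewrite mxE.
  have cc k : continuous (fun x : 'rV[R]_3 => x ord0 k) by exact: coord_continuous.
  have csum (f g : 'rV[R]_3 -> R) : continuous f -> continuous g ->
      continuous (fun x => f x + g x) by move=> fc gc x; apply: continuousD; [exact: fc|exact: gc].
  have cmul (f : 'rV[R]_3 -> R) (c : R) : continuous f ->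
      continuous (fun x => f x * c).
    by move=> fc; under eq_fun do rewrite mulrC; exact: continuous_mulrl.
  apply: (csum); first by move=> x; exact: cst_continuous.
  apply: continuous_mx_entry; apply: continuous_block_mx; apply: continuous_mxP => {}i {}j.
  - under eq_fun do rewrite mxE -mulr_natr; exact: cmul.
  - under eq_fun do rewrite !mxE -mulr_natr; apply: (csum); exact: cmul.
  - under eq_fun do rewrite !mxE -mulr_natr -mulrN; apply: (csum); exact: cmul.
  - under eq_fun do rewrite !mxE mulNrn -mulr_natr -mulrN; exact: cmul.
have cc m n (A : 'M[R]_(m, n)) : continuous (fun _ : 'rV[R]_3 => A).
  by move=> x; exact: cst_continuous.
have cb (D : 'M[R]_p) : continuous (fun x => block_mx (line_proj x) 0 0 D).
  exact: (continuous_block_mx c0 (cc _ _ _) (cc _ _ _) (cc _ _ _)).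
move=> x; exact: (cvg_pair (cb 0 x) (cb 1%:M x)).
Qed.

Lemma flag22_sphere m : exists L : set ('M[R]_(m.+2.*2) * 'M[R]_(m.+2.*2)),
  maximally_antipodal (@flag22 R m.+2) (@antipodal_flag R m.+2) L /\
  homeomorphic L (@sphere R 2).
Proof.
have [|||max inj] := @maximally_antipodal_image _ _ (@sphere R 2)
    (@line_flag m.*2 : _ -> 'M[R]_(m.+2.*2) * 'M[R]_(m.+2.*2))
    (@flag22 R m.+2) (@antipodal_flag R m.+2).
- by move=> x /sphere_dot xx; have [? ? ?] := line_flag_flag m.*2 xx; split.
- move=> x y /sphere_dot xx /sphere_dot yy xy.
  by split; apply: line_flag_antipodal => // /esym.
- move=> [V W] [/= [_ rV] _].
  have /rowV0Pn[v vV v0] : V != 0 by rewrite -mxrank_eq0 rV.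
  have [x xx vx] := @exists_line_flag m.*2 v.
  exists x; first exact/sphere_dot.
  by case=> + _; apply: not_complementary v0 vV vx.
eexists; split; first exact: max.
apply: homeomorphic_image => //.
- exact: sphere_compact.
- exact: continuous_line_flag.
Qed.

Lemma iso2_sphere k (Om : 'M[R]_(k.+2.*2)) : symplectic_mx Om ->
  exists L : set 'M[R]_(k.+2.*2),
    maximally_antipodal (@iso2 R k.+2 Om) (antipodal_iso Om) L /\
    homeomorphic L (@sphere R (k.*2.+1)).
Proof.
move: Om; rewrite -[k.+2.*2]/(2 + k.+1.*2)%N => Om [OmT uOm].
have [T [J [uT cJ TOT]]] := symplectic_complex_form OmT uOm.
pose C s := light_frame J s *m T.
have fC s : row_free (C s) by exact: row_free_light_frame.
have COC s t : C s *m Om *m (C t)^T =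
    light_frame J s *m block_mx J2 0 0 (- J) *m (light_frame J t)^T.
  by rewrite -TOT trmx_mul !mulmxA.
have rP s : \rank (orthoproj (C s)) = 2 by rewrite eqmx_orthoproj //; exact/eqP/fC.
(* Nondegeneracy gives the symplectic orthogonal of a plane codimension 2. *)
have rker s : (\rank (symp_orth Om (orthoproj (C s))) = k.+1.*2)%N.
  rewrite mxrank_ker -mxrank_tr trmx_mul trmxK mxrankMfree ?rP ?addKn //.
  by rewrite row_free_unit unitmx_tr.
have [|||max inj] := @maximally_antipodal_image _ _ (@sphere R k.*2.+1)
    (fun s => orthoproj (C s)) (@iso2 R k.+2 Om) (antipodal_iso Om).
- move=> s /sphere_dot ss; split; first split=> //.
    by split; [exact: orthoproj_idem|exact: orthoproj_sym].
  have /submxP[D PE] := orthoproj_sub (C s).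
  rewrite PE trmx_mul.
  transitivity (D *m (C s *m Om *m (C s)^T) *m D^T); first by rewrite !mulmxA.
  by rewrite COC light_frame_form0 // mulmx0 mul0mx.
- move=> s t /sphere_dot ss /sphere_dot tt st.
  apply: complementary_cap; first by rewrite rP rker.
  move=> x; rewrite eqmx_orthoproj // => /submxP[y ->] /sub_kermxP.
  (* Multiplying by [(C t)^T] replaces the projection by its frame, so y is killed by the invertible
     pairing matrix of the two frames. *)
  move=> /(congr1 (mulmx^~ (C t)^T)); rewrite mul0mx orthoproj_sym.
  have -> : y *m C s *m (Om *m orthoproj (C t)) *m (C t)^T =
      y *m (C s *m Om *m (C t)^T).
    have : orthoproj (C t) *m (C t)^T = (C t)^T.
      by rewrite -[in LHS]orthoproj_sym -trmx_mul mul_orthoproj.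
    by move: (orthoproj _) => P PC; rewrite -!mulmxA PC.
  rewrite COC => /(canRL (mulmxK (light_frame_form_unit cJ ss tt st))) ->.
  by rewrite !mul0mx.
- move=> P [[[PP PT] rkP] POP].
  have [K fK KP] := row_base_of_rank rkP.
  have KOK : K *m Om *m K^T = 0.
    have /submxP[D ->] : (K <= P)%MS by rewrite KP.
    rewrite trmx_mul; transitivity (D *m (P *m Om *m P^T) *m D^T); first by rewrite !mulmxA.
    by rewrite POP mulmx0 mul0mx.
  pose XY : 'M[R]_(2, 2 + k.+1.*2) := K *m invmx T.
  have KE : K = XY *m T by rewrite mulmxKV.
  (* Isotropy of the plane, written in the coordinates C + C^(n-1) of the normal form. *)
  have XYE : lsubmx XY *m J2 *m (lsubmx XY)^T = rsubmx XY *m J *m (rsubmx XY)^T.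
    apply/eqP; rewrite -subr_eq0 -mulNmx -mulmxN; apply/eqP.
    move: KOK; rewrite KE trmx_mul !mulmxA -(mulmxA XY) -(mulmxA XY) TOT.
    rewrite -[XY]hsubmxK row_mxKl row_mxKr; move: (lsubmx _) (rsubmx _) => X Y.
    by rewrite mul_row_block !mulmx0 addr0 add0r tr_row_mx mul_row_col.
  have [x [x0 xle xeq]] := exists_light_vector cJ XYE.
  have [|s ss sP] := exists_light_frame_perp cJ (ltn0Sn _) xle.
    (* The dimension [k.+1.*2] is at least 2, so being at most 2 means being equal to 2. *)
    by move=> q2; apply: xeq; apply/eqP; rewrite eqn_leq q2.
  exists s; first exact/sphere_dot.
  have xK0 : x *m K != 0 by rewrite mulmx_free_eq0.
  apply: (not_complementary xK0); first by rewrite -KP submxMl.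
  apply/sub_kermxP; have /submxP[D ->] := orthoproj_sub (C s).
  rewrite trmx_mul !mulmxA.
  suff -> : x *m K *m Om *m (C s)^T = 0 by rewrite mul0mx.
  rewrite -sP -TOT -mul_mx_row hsubmxK KE trmx_mul !mulmxA //.
exists ((fun s => orthoproj (C s)) @` @sphere R k.*2.+1); split; first exact: max.
apply: homeomorphic_image => //.
- exact: sphere_compact.
- apply: continuous_orthoproj => //.
  have cc m n (A : 'M[R]_(m, n)) : continuous (fun _ : 'rV[R]_(k.+1.*2) => A).
    by move=> x; exact: cst_continuous.
  have cid : continuous (fun x : 'rV[R]_(k.+1.*2) => x) by move=> x.
  apply: continuous_mulmx => //; apply: continuous_row_mx => //.
  by apply: continuous_col_mx => //; exact: continuous_mulmx.
Qed.

End Antipodality.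

Theorem theorem1p2 (R : realType) (n : nat) (hn : (2 <= n)%N) :
  (exists L : set ('M[R]_(n.*2) * 'M[R]_(n.*2)),
      maximally_antipodal (@flag22 R n) (@antipodal_flag R n) L /\
      homeomorphic L (@sphere R 2))
  /\
  (forall Om : 'M[R]_(n.*2), symplectic_mx Om ->
     exists L : set 'M[R]_(n.*2),
       maximally_antipodal (@iso2 R n Om) (antipodal_iso Om) L /\
       homeomorphic L (@sphere R (n.*2 - 3))).
Proof.
case: n hn => [|[|m]] // _; split; first exact: flag22_sphere.
(* For n = m + 2, [n.*2 - 3] computes to [m.*2.+1]; this sphere lies in R^(2n-2) = C^(n-1). *)
exact: iso2_sphere.
Qed.
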